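(* Let $G=(V,E)$ be an undirected connected graph, let $S\subset V$ and $|S|=3$. Then $S$ is not a minimum perfect critical set of $G$.
   Context: Graphs are finite, undirected, unweighted and simple. For a graph $G=(V,E)$ with $V=\{v_1,\dots,v_n\}$, the Laplacian is $L=\Delta(G)-D(G)$, where $\Delta(G)$ is the diagonal matrix of vertex degrees and $D(G)$ is the $0$-$1$ adjacency matrix. For $S\subset V$ put $\overline{S}=V\setminus S$. For a vector $y$ indexed by $V$, $y_S$ denotes the vector obtained from $y$ by deleting the entries indexed by $\overline{S}$; eigenvectors are nonzero. A nonempty $S\subseteq V$ is a critical set if there is an eigenvector $y$ of $L$ with $y_{\overline{S}}=0$. A critical set $S$ is a perfect critical set if there is an eigenvector $y$ of $L$ with $y_{\overline{S}}=0$ and $y_v\neq 0$ for every $v\in S$. A perfect critical set is a minimum perfect critical set if no proper subset of it is a perfect critical set. *)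

(* Defs.v *)
From mathcomp Require Import all_boot all_order all_algebra.
From mathcomp Require Import reals.

Set Implicit Arguments.
Unset Strict Implicit.
Unset Printing Implicit Defensive.

Import GRing.Theory Num.Theory.
Local Open Scope ring_scope.

(* The graph v_1, ..., v_n is given by its adjacency relation on 'I_n. *)
Definition simple_graph (n : nat) (e : rel 'I_n) : Prop :=
  symmetric e /\ irreflexive e.

Definition connected_graph (n : nat) (e : rel 'I_n) : Prop :=
  (0 < n)%N /\ forall u v : 'I_n, connect e u v.

Definition degree (n : nat) (e : rel 'I_n) (u : 'I_n) : nat :=
  #|[set v | e u v]|.

Definition degree_mx (R : realType) (n : nat) (e : rel 'I_n) : 'M[R]_n :=
  diag_mx (\row_u (degree e u)%:R).

Definition adjacency_mx (R : realType) (n : nat) (e : rel 'I_n) : 'M[R]_n :=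
  \matrix_(u, v) (e u v)%:R.

Definition laplacian (R : realType) (n : nat) (e : rel 'I_n) : 'M[R]_n :=
  degree_mx R e - adjacency_mx R e.

(* MathComp's eigenspace is about row vectors; these are column vectors. *)
Definition eigenvector (R : realType) (n : nat) (A : 'M[R]_n) (y : 'cV[R]_n)
    : Prop :=
  y != 0 /\ exists lambda : R, A *m y = lambda *: y.

Definition critical_set (R : realType) (n : nat) (e : rel 'I_n)
    (S : {set 'I_n}) : Prop :=
  S != set0 /\
  exists y : 'cV[R]_n,
    eigenvector (laplacian R e) y /\ (forall v, v \in ~: S -> y v 0 = 0).

Definition perfect_critical_set (R : realType) (n : nat) (e : rel 'I_n)
    (S : {set 'I_n}) : Prop :=
  critical_set R e S /\
  exists y : 'cV[R]_n,
    [/\ eigenvector (laplacian R e) y,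
        forall v, v \in ~: S -> y v 0 = 0
      & forall v, v \in S -> y v 0 != 0].

Definition minimum_perfect_critical_set (R : realType) (n : nat)
    (e : rel 'I_n) (S : {set 'I_n}) : Prop :=
  perfect_critical_set R e S /\
  forall T : {set 'I_n}, T \proper S -> ~ perfect_critical_set R e T.

(* Main.v *)
(* A Laplacian eigenvector y supported exactly on S = {a, b, c} either has
   eigenvalue 0, in which case it is constant by connectivity and S = V, or is
   orthogonal to the all-ones vector.  In the second case a proper nonempty
   subset of S has nonzero y-sum, so the eigenvalue equation at a vertex outside
   S forces it to be adjacent to all of S or to none of it.  Among the three
   pairs in S, two agree on being edges, so in both cases two vertices of S, say
   a and b, have the same neighbours outside {a, b}; then delta_a - delta_b is
   an eigenvector. *)
Require Import Defs.
From mathcomp Require Import all_boot all_order all_algebra.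
From mathcomp Require Import reals.
From mathcomp Require Import all_fingroup ring lra.

Set Implicit Arguments.
Unset Strict Implicit.
Unset Printing Implicit Defensive.

Import GRing.Theory Num.Theory.
Local Open Scope ring_scope.

Lemma natr_degree (R : realType) (n : nat) (e : rel 'I_n) (u : 'I_n) :
  (degree e u)%:R = \sum_v (e u v)%:R :> R.
Proof.
rewrite /degree -sum1_card natr_sum big_mkcond /=.
by apply: eq_bigr => v _; rewrite inE; case: (e u v).
Qed.

Lemma laplacian_mulmxE (R : realType) (n : nat) (e : rel 'I_n)
    (y : 'cV[R]_n) (u : 'I_n) :
  (laplacian R e *m y) u 0 =
    (degree e u)%:R * y u 0 - \sum_v (e u v)%:R * y v 0.
Proof.
rewrite /laplacian mulmxBl /degree_mx mul_diag_mx !mxE; congr (_ - _).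
by apply: eq_bigr => v _; rewrite mxE.
Qed.

Lemma laplacian_mulmx_diffE (R : realType) (n : nat) (e : rel 'I_n)
    (y : 'cV[R]_n) (u : 'I_n) :
  (laplacian R e *m y) u 0 = \sum_v (e u v)%:R * (y u 0 - y v 0).
Proof.
rewrite laplacian_mulmxE natr_degree mulr_suml -sumrB.
by apply: eq_bigr => v _; rewrite mulrBr.
Qed.

(** Each edge contributes [y u 0 - y v 0] at one end and its opposite at the other, so exchanging
    the two summations shows the total to be its own negative. *)
Lemma sum_laplacian_mulmx (R : realType) (n : nat) (e : rel 'I_n)
    (y : 'cV[R]_n) :
  symmetric e -> \sum_u (laplacian R e *m y) u 0 = 0.
Proof.
move=> e_sym; under eq_bigr do rewrite laplacian_mulmx_diffE.
set s := LHS; suff: s = - s by move/eqP; rewrite -addr_eq0; lra.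
rewrite {1}/s exchange_big /= -sumrN; apply: eq_bigr => u _.
by rewrite -sumrN; apply: eq_bigr => v _; rewrite e_sym; ring.
Qed.

(** Both orientations of an edge are summed, and [y u * (y u - y v) + y v * (y v - y u)] is the
    square of the difference. *)
Lemma laplacian_quadratic_form (R : realType) (n : nat) (e : rel 'I_n)
    (y : 'cV[R]_n) :
  symmetric e ->
  (\sum_u y u 0 * (laplacian R e *m y) u 0) *+ 2 =
    \sum_u \sum_v (e u v)%:R * (y u 0 - y v 0) ^+ 2.
Proof.
move=> e_sym.
have sum_yL : \sum_u y u 0 * (laplacian R e *m y) u 0 =
    \sum_u \sum_v (e u v)%:R * (y u 0 * (y u 0 - y v 0)).
  apply: eq_bigr => u _; rewrite laplacian_mulmx_diffE mulr_sumr.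
  by apply: eq_bigr => v _; rewrite mulrCA.
rewrite mulr2n sum_yL {2}exchange_big /= -big_split /=.
apply: eq_bigr => u _; rewrite -big_split /=; apply: eq_bigr => v _.
by rewrite (e_sym v u); ring.
Qed.

(** The quadratic form vanishes at [y], hence so does each of its nonnegative terms; thus [y] agrees
    across every edge, and then along paths. *)
Lemma laplacian_kernel_const (R : realType) (n : nat) (e : rel 'I_n)
    (y : 'cV[R]_n) (u v : 'I_n) :
  symmetric e -> laplacian R e *m y = 0 -> connect e u v -> y u 0 = y v 0.
Proof.
move=> e_sym Ly0.
have term_ge0 i j : 0 <= (e i j)%:R * (y i 0 - y j 0) ^+ 2.
  by rewrite mulr_ge0 ?ler0n ?sqr_ge0.
have yE i j : e i j -> y i 0 = y j 0.
  move=> eij; have /esym/eqP := laplacian_quadratic_form y e_sym.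
  rewrite Ly0 [X in _ == X *+ _]big1 => [|k _]; last by rewrite mxE mulr0.
  rewrite mul0rn.
  rewrite psumr_eq0 => [/allP/(_ i)|k _]; last exact: sumr_ge0.
  rewrite mem_index_enum psumr_eq0 // => /(_ isT)/allP/(_ j).
  rewrite mem_index_enum eij mul1r sqrf_eq0 subr_eq0.
  by move/(_ isT)/eqP.
case/connectP => p; elim: p u => [|w p IHp] u /= => [_ -> //|].
by case/andP => /yE -> /IHp; apply.
Qed.

(** The transposition of [a] and [b] maps the neighbours of [a] onto those of [b], whether or not
    [a] and [b] are adjacent. *)
Lemma degree_twin (n : nat) (e : rel 'I_n) (a b : 'I_n) :
  simple_graph e -> (forall u, u != a -> u != b -> e u a = e u b) ->
  degree e a = degree e b.
Proof.
case=> e_sym e_irr twin_ab.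
rewrite /degree -(card_imset _ (@perm_inj _ (tperm a b))); congr #|pred_of_set _|.
apply/setP => v; rewrite -[v in LHS](tpermK a b) mem_imset; last exact: perm_inj.
rewrite !inE; case: tpermP => [->|->|/eqP va /eqP vb]; last 1 first.
- by rewrite e_sym (e_sym b) twin_ab.
- by rewrite e_sym.
- by rewrite !e_irr.
Qed.

Lemma twin_perfect_critical_set (R : realType) (n : nat) (e : rel 'I_n)
    (a b : 'I_n) :
  simple_graph e -> a != b ->
  (forall u, u != a -> u != b -> e u a = e u b) ->
  perfect_critical_set R e [set a; b].
Proof.
move=> simple_e ab twin_ab; have [e_sym e_irr] := simple_e.
pose y : 'cV[R]_n := delta_mx a 0 - delta_mx b 0.
have yE v : y v 0 = (v == a)%:R - (v == b)%:R by rewrite !mxE !eqxx !andbT.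
have y_out v : v \in ~: [set a; b] -> y v 0 = 0.
  by rewrite !inE negb_or yE => /andP[/negPf-> /negPf->]; rewrite subrr.
have y_in v : v \in [set a; b] -> y v 0 != 0.
  rewrite !inE yE => /orP[] /eqP ->; rewrite eqxx.
    by rewrite (negPf ab) subr0 oner_eq0.
  by rewrite (eq_sym b) (negPf ab) sub0r oppr_eq0 oner_eq0.
have sum_ey u : \sum_v (e u v)%:R * y v 0 = (e u a)%:R - (e u b)%:R :> R.
  under eq_bigr do rewrite yE mulrBr.
  rewrite sumrB; congr (_ - _).
    rewrite (bigD1 a) //= eqxx mulr1 big1 ?addr0 // => v /negPf->.
    by rewrite mulr0.
  rewrite (bigD1 b) //= eqxx mulr1 big1 ?addr0 // => v /negPf->.
  by rewrite mulr0.
have y_eig : eigenvector (laplacian R e) y.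
  split.
    apply/eqP => y0; have := y_in a (set21 a b).
    by rewrite y0 mxE eqxx.
  (* The eigenvalue is read off at [a], where [y] is 1 and the neighbour sum is [- e a b]. *)
  exists ((degree e a)%:R + (e a b)%:R); apply/matrixP => u j.
  rewrite (ord1 j) laplacian_mulmxE sum_ey [RHS]mxE yE.
  have [->|ua] := eqVneq u a.
    by rewrite (negPf ab) e_irr /=; ring.
  have [->|ub] := eqVneq u b; last by rewrite twin_ab //=; ring.
  by rewrite -(degree_twin simple_e twin_ab) e_irr (e_sym b) /=; ring.
split; last by exists y.
by split; [apply/set0Pn; exists a; rewrite set21 | exists y].
Qed.

(** The condition at [c] and the one outside the triple together make [a] and [b] twins, so the
    proper subset [[set a; b]] is already perfect critical. *)
Lemma not_minimum_of_twins (R : realType) (n : nat) (e : rel 'I_n)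
    (a b c : 'I_n) :
  simple_graph e -> a != b -> c != a -> c != b -> e c a = e c b ->
  (forall u, u \notin [set a; b; c] -> e u a = e u b) ->
  ~ minimum_perfect_critical_set R e [set a; b; c].
Proof.
move=> simple_e ab ca cb e_c e_out [_ /(_ [set a; b])]; apply.
  apply/properP; split; first exact: subsetUl.
  by exists c; rewrite !inE ?eqxx ?orbT // negb_or ca.
apply: twin_perfect_critical_set => // u ua ub.
have [->//|uc] := eqVneq u c.
by apply: e_out; rewrite !inE !negb_or ua ub.
Qed.

Theorem theorem3 (R : realType) (n : nat) (e : rel 'I_n)
    (simple_e : simple_graph e) (connected_e : connected_graph e)
    (S : {set 'I_n}) (card_S : #|S| = 3) :
  ~ minimum_perfect_critical_set R e S.
Proof.
have [e_sym e_irr] := simple_e.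
have /card_gt2P[a [b [c [[aS bS cS] [ab bc ca]]]]] : (2 < #|S|)%N by rewrite card_S.
have SE : S = [set a; b; c].
  apply/esym/eqP; rewrite eqEcard card_S; apply/andP; split.
    by apply/subsetP => v; rewrite !inE -orbA => /or3P[] /eqP->.
  by rewrite setUC cardsU1 !inE negb_or ca eq_sym bc cards2 ab.
move=> minS; have [[_ [y [[y_neq0 [lambda Ly]] y_out y_in]]] _] := minS.
have sumS (f : 'I_n -> R) : \sum_v f v * y v 0 =
    f a * y a 0 + f b * y b 0 + f c * y c 0.
  rewrite (bigD1 a) // (bigD1 b) 1?eq_sym //= (bigD1 c) /=; last first.
    by rewrite ca eq_sym bc.
  rewrite big1 ?addr0 ?addrA // => v /andP[/andP[va vb] vc].
  by rewrite y_out ?mulr0 // !inE SE !inE !negb_or va vb.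
have e_out u : u \notin S -> e u a = e u b /\ e u b = e u c.
  move=> uS; have [lambda0|lambda_neq0] := eqVneq lambda 0.
    (* Eigenvalue 0 would force [y a 0 = y u 0], but the former is nonzero and the latter is 0. *)
    have := y_in a aS; rewrite (@laplacian_kernel_const _ _ e y a u) //.
    - by rewrite y_out ?eqxx // inE.
    - by rewrite Ly lambda0 scale0r.
    - by have [_] := connected_e; apply.
  have sum_y : y a 0 + y b 0 + y c 0 = 0.
    have := sum_laplacian_mulmx y e_sym; rewrite Ly.
    under eq_bigr do rewrite mxE.
    rewrite (sumS (fun=> lambda)) -!mulrDr => /eqP.
    by rewrite mulf_eq0 (negPf lambda_neq0) => /eqP.
  have : (laplacian R e *m y) u 0 = 0.
    by rewrite Ly mxE y_out ?mulr0 // inE.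
  rewrite laplacian_mulmxE y_out ?inE // mulr0 sumS sub0r => /eqP.
  rewrite oppr_eq0 => /eqP.
  have := y_in a aS; have := y_in b bS; have := y_in c cS.
  move=> /eqP yc /eqP yb /eqP ya.
  (* If [u] has exactly one neighbour in [S], the entry there vanishes; if exactly two, [sum_y]
     makes the third entry vanish. *)
  by case: (e u a); case: (e u b); case: (e u c) => //= sum_eu; exfalso;
    (apply: ya; lra) || (apply: yb; lra) || (apply: yc; lra).
have [e_c|e_c] := boolP (e c a == e c b).
  apply: (@not_minimum_of_twins R n e a b c) => //; rewrite -?SE //; try exact/eqP.
  - by rewrite eq_sym.
  - by move=> u /e_out[].
have [e_a|e_a] := boolP (e a b == e a c).
  apply: (@not_minimum_of_twins R n e b c a) => //; rewrite 1?eq_sym //; first exact/eqP.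
  - move=> u; rewrite setUC setUA -SE; by case/e_out.
  - by rewrite setUC setUA -SE.
(* Both [e b c] and [e b a] now differ from the boolean [e a c], so they coincide. *)
have e_b : e b c = e b a.
  move: e_c e_a; rewrite (e_sym c a) (e_sym c b) (e_sym a b).
  by case: (e a c); case: (e b c); case: (e b a).
apply: (@not_minimum_of_twins R n e c a b) => //; rewrite 1?eq_sym //.
- by move=> u; rewrite -setUA setUC -SE => /e_out[-> ->].
- by rewrite -setUA setUC -SE.
Qed.
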